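(* Let $X\in\mathfrak{q}$ be such that $\operatorname{Ad}(H)X$ is a pseudo-Riemannian submanifold of a pseudo-hypersphere $\boldsymbol{S}=\{v\in\mathfrak{q}\mid B(v,v)=r\}$, $r>0$. Let $\theta$ be a Cartan involution of $\mathfrak{g}$ satisfying $\theta\circ\sigma=\sigma\circ\theta$ and $\theta(\mathfrak{g}_X)=\mathfrak{g}_X$. Let $\{\mathfrak{a}_1,\dots,\mathfrak{a}_m\}$ be a complete set of representatives for $\mathcal{CS}_X/H_X$ consisting of $\theta$-invariant Cartan subspaces. Then for any $\mathfrak{a}_i$ and $\mathfrak{a}_j$ ($1\le i\ne j\le m$) there exists a Lie algebra automorphism $\psi$ of $\mathfrak{g}^{\mathbb{C}}$ satisfying $\psi\circ\sigma=\sigma\circ\psi$, $\psi(\mathfrak{a}_i^{\mathbb{C}}\ominus\mathbb{C}X)=\mathfrak{a}_j^{\mathbb{C}}\ominus\mathbb{C}X$ and $\psi(X)=X$.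
   Context: $G$ is a connected semisimple noncompact real Lie group, $\sigma$ an involution of $G$, $H$ a closed subgroup with $(G_\sigma)_0\subset H\subset G_\sigma$ ($G_\sigma$ the fixed point group of $\sigma$). $\mathfrak{g}=\operatorname{Lie}(G)$, $\mathfrak{h}=\operatorname{Lie}(H)$ is the $(+1)$-eigenspace and $\mathfrak{q}$ the $(-1)$-eigenspace of the induced involution $\sigma$ of $\mathfrak{g}$, extended complex-linearly to $\mathfrak{g}^{\mathbb{C}}$; $B$ is the Killing form of $\mathfrak{g}$ (extended complex-bilinearly to $\mathfrak{g}^{\mathbb{C}}$). $H$ acts on $\mathfrak{q}$ by $\operatorname{Ad}$; ''pseudo-Riemannian submanifold'' means that the metric induced from $B|_{\mathfrak{q}}$ is nondegenerate (under this assumption $X$ is semisimple, i.e. $\operatorname{ad}(X)$ is diagonalizable over $\mathbb{C}$). A Cartan subspace of $\mathfrak{q}$ is a maximal abelian subspace of $\mathfrak{q}$ consisting of semisimple elements. $\mathfrak{g}_X$ is the centralizer of $X$ in $\mathfrak{g}$; $\mathcal{CS}_X$ is the set of all Cartan subspaces of $\mathfrak{q}$ containing $X$; $H_X$ is the isotropy subgroup of $H$ at $X$, acting on $\mathcal{CS}_X$ by $\operatorname{Ad}$. $\mathfrak{a}^{\mathbb{C}}\ominus\mathbb{C}X$ is the $B$-orthogonal complement of $X$ in $\mathfrak{a}^{\mathbb{C}}$. *)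

(* Defs.v *)
From HB Require Import structures.
From mathcomp Require Import all_boot all_order all_algebra.
From mathcomp Require Import all_classical all_reals all_analysis.
From mathcomp Require Import complex.

Set Implicit Arguments.
Unset Strict Implicit.
Unset Printing Implicit Defensive.

Import Order.TTheory GRing.Theory Num.Theory numFieldNormedType.Exports.
Import passmx.

Local Open Scope classical_set_scope.
Local Open Scope ring_scope.
Local Open Scope complex_scope.

HB.mixin Record Lmodule_isLie (K : fieldType) L of GRing.Lmodule K L := {
  lie : L -> L -> L;
  lie_linearl : forall y, linear (lie^~ y);
  lie_linearr : forall x, linear (lie x);
  liexx : forall x, lie x x = 0;
  lie_jacobi : forall x y z,
    lie x (lie y z) + lie y (lie z x) + lie z (lie x y) = 0
}.

#[short(type="lieAlgType")]
HB.structure Definition LieAlgebra (K : fieldType) :=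
  {L of GRing.Lmodule K L & Lmodule_isLie K L}.

#[short(type="finLieAlgType")]
HB.structure Definition FinLieAlgebra (K : fieldType) :=
  {L of Vector K L & Lmodule_isLie K L}.

HB.instance Definition _ (K : fieldType) (L : lieAlgType K) (x : L) :=
  GRing.isLinear.Build K L L *:%R (lie x) (lie_linearr x).

Definition lie_automorphism (K : fieldType) (L : lieAlgType K) (f : L -> L) :=
  [/\ linear f, bijective f & {morph f : x y / lie x y}].

Definition lie_involution (K : fieldType) (L : lieAlgType K) (f : L -> L) :=
  lie_automorphism f /\ (forall x, f (f x) = x).

Section FinLie.
Variables (K : fieldType) (g : finLieAlgType K).
Implicit Types (x y : g) (I J : {vspace g}).

Definition ad x : 'End(g) := linfun (lie x).

Definition ad_mx x : 'M[K]_(\dim {:g}) :=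
  mxof (vbasis {:g}) (vbasis {:g}) (ad x).

Definition killing x y : K := \tr (ad_mx x *m ad_mx y).

Definition centralizer x : {vspace g} := lker (ad x).

Definition lie_prod I J : {vspace g} :=
  <<[seq lie x y | x <- vbasis I, y <- vbasis J]>>%VS.

Definition solvable_lie I :=
  exists k, iter k (fun J => lie_prod J J) I = 0%VS.

Definition lie_ideal I := forall x y, y \in I -> lie x y \in I.

Definition semisimple_lie :=
  forall I, lie_ideal I -> solvable_lie I -> I = 0%VS.

End FinLie.

(* The pair (x, y) stands for x + i y. *)
Definition complexification (R : realType) (g : lieAlgType R) : Type :=
  (g * g)%type.

Section Complexification.
Variables (R : realType) (g : lieAlgType R).
Local Notation gC := (complexification g).

HB.instance Definition _ := GRing.Zmodule.copy gC (g * g)%type.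

Definition cpair (x y : g) : gC := (x, y).

Definition cscale (c : R[i]) (v : gC) : gC :=
  cpair (complex.Re c *: v.1 - complex.Im c *: v.2) (complex.Re c *: v.2 + complex.Im c *: v.1).

Lemma cpairD (x y x' y' : g) :
  cpair x y + cpair x' y' = cpair (x + x') (y + y').
Proof. by []. Qed.

Lemma cscaleA c d v : cscale c (cscale d v) = cscale (c * d) v.
Proof.
case: c d v => [a b] [c d] [x y]; rewrite /cscale /=.
congr cpair; rewrite !(scalerDr, scalerBl, scalerDl, scalerN) !scalerA ?opprD !addrA.
  by rewrite [LHS](ACl (1*4*2*3)).
by rewrite [LHS](ACl (1*4*2*3)) /=; congr (_ + _ + _ + _).
Qed.

Lemma cscale1 : left_id 1 cscale.
Proof.
by case=> x y; rewrite /cscale /= !scale1r !scale0r subr0 addr0.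
Qed.

Lemma cscaleDr : right_distributive cscale +%R.
Proof.
move=> c [x y] [x' y']; rewrite /cscale cpairD /= !scalerDr.
by rewrite opprD; congr cpair; rewrite addrACA.
Qed.

Lemma cscaleDl v : {morph cscale^~ v : c d / c + d}.
Proof.
case=> a b [c d]; case: v => x y; rewrite /cscale cpairD /= !scalerDl.
by rewrite opprD; congr cpair; rewrite addrACA.
Qed.

HB.instance Definition _ :=
  GRing.Zmodule_isLmodule.Build R[i] gC cscaleA cscale1 cscaleDr cscaleDl.

Definition clie (v w : gC) : gC :=
  cpair (lie v.1 w.1 - lie v.2 w.2) (lie v.1 w.2 + lie v.2 w.1).

Lemma lieDl (x y z : g) : lie (x + y) z = lie x z + lie y z.
Proof. by have := lie_linearl z 1 x y; rewrite !scale1r. Qed.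

Lemma lie0l (z : g) : lie 0 z = 0.
Proof. by apply: (addrI (lie 0 z)); rewrite -lieDl !addr0. Qed.

Lemma lieZl a (x z : g) : lie (a *: x) z = a *: lie x z.
Proof. by have := lie_linearl z a x 0; rewrite addr0 lie0l addr0. Qed.

Lemma lieNl (x z : g) : lie (- x) z = - lie x z.
Proof. by rewrite -scaleN1r lieZl scaleN1r. Qed.

Lemma lieC (x y : g) : lie x y = - lie y x.
Proof.
apply/eqP; rewrite -addr_eq0; apply/eqP.
by have := liexx (x + y); rewrite lieDl !raddfD /= !liexx addr0 add0r.
Qed.


Lemma clieC v w : clie v w = - clie w v.
Proof.
rewrite /clie (lieC w.1) (lieC w.2 v.2) (lieC w.1 v.2) (lieC w.2 v.1).
by congr cpair; rewrite /= ?opprB ?opprD !opprK // addrC.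
Qed.

Lemma clieDr v w1 w2 : clie v (w1 + w2) = clie v w1 + clie v w2.
Proof.
rewrite /clie cpairD /= !raddfD /=.
by congr cpair; rewrite ?opprD addrACA.
Qed.

Lemma clieZr v c w : clie v (c *: w) = c *: clie v w.
Proof.
case: c v w => a b [x y] [z t]; rewrite /clie /GRing.scale /= /cscale /=.
rewrite !(raddfD, raddfN) /= !linearZ /=.
by congr cpair; rewrite addrACA.
Qed.

Lemma clie_linearr v : linear (clie v).
Proof. by move=> c w1 w2; rewrite clieDr clieZr. Qed.

Lemma clie_linearl w : linear (clie^~ w).
Proof.
by move=> c v1 v2; rewrite ![clie _ w]clieC clieDr clieZr opprD scalerN.
Qed.

Lemma cliexx v : clie v v = 0.
Proof. by rewrite /clie !liexx subrr (lieC v.2) subrr. Qed.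

Lemma clie_jacobi u v w :
  clie u (clie v w) + clie v (clie w u) + clie w (clie u v) = 0.
Proof.
case: u v w => [a1 a2] [b1 b2] [c1 c2]; rewrite /clie !cpairD /=.
rewrite !(raddfD, raddfN) /=.
have J x y z := lie_jacobi x y z.
congr cpair; rewrite !addrA.
  rewrite [LHS](ACl ((1*5*9)*(2*8*11)*(3*6*12)*(4*7*10))) /=.
  by rewrite J -!opprD !J !oppr0 !addr0.
rewrite [LHS](ACl ((1*6*11)*(2*7*9)*(3*5*10)*(4*8*12))) /=.
by rewrite !J -!opprD !J oppr0 !addr0.
Qed.

HB.instance Definition _ :=
  Lmodule_isLie.Build R[i] gC clie_linearl clie_linearr cliexx clie_jacobi.

Definition cextend (f : g -> g) (v : gC) : gC := cpair (f v.1) (f v.2).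

Definition of_real (x : g) : gC := cpair x 0.

End Complexification.

Definition killingC (R : realType) (g : finLieAlgType R)
    (v w : complexification g) : R[i] :=
  (killing v.1 w.1 - killing v.2 w.2) +i* (killing v.1 w.2 + killing v.2 w.1).

(* a^C (-) C x, the orthogonal complement of x in a^C *)
Definition cominus (R : realType) (g : finLieAlgType R) (a : {vspace g}) (x : g)
    : set (complexification g) :=
  [set v | [/\ v.1 \in a, v.2 \in a & killingC v (of_real x) = 0]].

(* C^k on U; meant for U open in a finite-dimensional space, where the iterated
   directional derivatives control all higher differentials. *)
Fixpoint Ck_on (R : realType) (k : nat) (V W : normedModType R) (U : set V)
    (f : V -> W) : Prop :=
  match k with
  | 0 => forall x, U x -> {for x, continuous f}
  | k'.+1 => (forall x, U x -> differentiable f x) /\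
             (forall v, Ck_on k' U ('D_v f))
  end.

Definition smooth_on (R : realType) (V W : normedModType R) (U : set V)
  (f : V -> W) := forall k, Ck_on k U f.

(* Only the values of coord on dom and of coord_inv on coord @` dom are
   relevant. *)
Record chart (R : realType) (n : nat) (M : Type) := Chart {
  dom : set M;
  coord : M -> 'rV[R]_n;
  coord_inv : 'rV[R]_n -> M
}.

Section Manifold.
Variables (R : realType) (n : nat) (M : topologicalType).
Implicit Types (c : chart R n M) (A : set (chart R n M)).

Definition is_chart c :=
  [/\ open (dom c), open (coord c @` dom c),
      (forall x, dom c x -> coord_inv c (coord c x) = x),
      {within dom c, continuous (coord c)} &
      {within coord c @` dom c, continuous (coord_inv c)}].

Definition smooth_atlas A :=
  [/\ (forall c, A c -> is_chart c),
      (forall x, exists2 c, A c & dom c x) &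
      (forall c d, A c -> A d ->
        smooth_on (coord c @` (dom c `&` dom d)) (coord d \o coord_inv c))].

Definition smooth_manifold A :=
  [/\ hausdorff_space M, @second_countable M & smooth_atlas A].

Definition smooth_map A (f : M -> M) :=
  continuous f /\
  (forall c d, A c -> A d ->
    smooth_on (coord c @` (dom c `&` f @^-1` dom d))
              (coord d \o f \o coord_inv c)).

Definition smooth_map2 A (f : M -> M -> M) :=
  continuous (fun p : M * M => f p.1 p.2) /\
  (forall c1 c2 d, A c1 -> A c2 -> A d ->
    smooth_on
      [set (coord c1 p.1, coord c2 p.2) |
        p in [set p : M * M | [/\ dom c1 p.1, dom c2 p.2 & dom d (f p.1 p.2)]]]
      (fun u : 'rV[R]_n * 'rV[R]_n =>
         coord d (f (coord_inv c1 u.1) (coord_inv c2 u.2)))).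

End Manifold.

HB.mixin Record isLieGroup (R : realType) (n : nat) G
    of Group G & Topological G := {
  atlas : set (chart R n G);
  atlas_manifold : smooth_manifold atlas;
  mulg_smooth : smooth_map2 atlas (fun x y : G => (x * y)%g);
  invg_smooth : smooth_map atlas (fun x : G => (x^-1)%g)
}.

#[short(type="lieGroupType")]
HB.structure Definition LieGroup (R : realType) (n : nat) :=
  {G of Group G & Topological G & isLieGroup R n G}.

(* The differential at 1, read in the chart c, of a map f fixing 1. *)
Definition diff1 (R : realType) (n : nat) (G : lieGroupType R n)
    (c : chart R n G) (f : G -> G) (v : 'rV[R]_n) : 'rV[R]_n :=
  'D_v (coord c \o f \o coord_inv c) (coord c 1%g).

Definition conjl (G : groupType) (x y : G) : G := (x * y * x^-1)%g.

(* g is the Lie algebra of G: a chart at 1 identifies T_1 G with 'rV[R]_n, and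
   lag_tangent identifies g with T_1 G. With Ad x the differential at 1 of
   conjugation by x, the bracket is the differential of Ad at 1:
   [x, y] = d/dt Ad(gamma(t)) y at t = 0, where gamma(0) = 1, gamma'(0) = x. *)
Record lie_algebra_of (R : realType) (n : nat) (G : lieGroupType R n)
    (g : finLieAlgType R) := LieAlgebraOf {
  lag_chart : chart R n G;
  lag_atlas : atlas lag_chart;
  lag_dom1 : dom lag_chart 1%g;
  lag_tangent : {linear g -> 'rV[R]_n};
  lag_tangent_inv : 'rV[R]_n -> g;
  lag_tangentK : cancel lag_tangent lag_tangent_inv;
  lag_tangent_invK : cancel lag_tangent_inv lag_tangent;
  lag_bracket : forall x y : g,
    lag_tangent (lie x y) =
    'D_(lag_tangent x)
      (fun u => diff1 lag_chart (conjl (coord_inv lag_chart u)) (lag_tangent y))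
      (coord lag_chart 1%g)
}.

Section Symmetric.
Variables (R : realType) (n : nat) (G : lieGroupType R n).
Variables (g : finLieAlgType R) (E : lie_algebra_of G g).

Definition lie_diff (f : G -> G) (x : g) : g :=
  lag_tangent_inv E (diff1 (lag_chart E) f (lag_tangent E x)).

Definition Ad (x : G) : g -> g := lie_diff (conjl x).

Definition group_involution (sigma : G -> G) :=
  [/\ smooth_map atlas sigma, {morph sigma : x y / (x * y)%g} &
      forall x, sigma (sigma x) = x].

Definition fixed_group (sigma : G -> G) : set G := [set x | sigma x = x].

Definition subgroup (H : set G) :=
  [/\ H 1%g, (forall x y, H x -> H y -> H (x * y)%g) &
      (forall x, H x -> H (x^-1)%g)].

(* Below, s is the involution of g induced by sigma; plus_space s is the Lie
   algebra h of H, and minus_space s is q. *)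

Definition plus_space (s : 'End(g)) : {vspace g} := leigenspace s 1.
Definition minus_space (s : 'End(g)) : {vspace g} := leigenspace s (- 1).

Definition pseudo_hypersphere (s : 'End(g)) (r : R) : set g :=
  [set v | v \in minus_space s /\ killing v v = r].

Definition Ad_orbit (H : set G) (X : g) : set g := [set Ad x X | x in H].

(* The differential at 1 of the orbit map x |-> Ad x v of H is z |-> [z, v] on
   T_1 H = h, so T_v (Ad(H) X) = [h, v] = ad v (h). *)
Definition orbit_tangent (s : 'End(g)) (v : g) : {vspace g} :=
  (ad v @: plus_space s)%VS.

Definition nondegenerate_on (U : {vspace g}) :=
  forall u, u \in U -> (forall w, w \in U -> killing u w = 0) -> u = 0.

Definition pseudo_riemannian_orbit (s : 'End(g)) (H : set G) (X : g) (r : R) :=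
  Ad_orbit H X `<=` pseudo_hypersphere s r /\
  (forall v, Ad_orbit H X v -> nondegenerate_on (orbit_tangent s v)).

Definition cartan_involution (theta : 'End(g)) :=
  lie_involution theta /\ (forall x, x != 0 -> 0 < - killing x (theta x)).

Definition semisimple_elt (x : g) :=
  diagonalizable (map_mx (real_complex R) (ad_mx x)).

Definition abelian_semisimple (s : 'End(g)) (a : {vspace g}) :=
  [/\ (a <= minus_space s)%VS,
      (forall x y, x \in a -> y \in a -> lie x y = 0) &
      (forall x, x \in a -> semisimple_elt x)].

Definition cartan_subspace (s : 'End(g)) (a : {vspace g}) :=
  abelian_semisimple s a /\
  (forall b, abelian_semisimple s b -> (a <= b)%VS -> b = a).

Definition cartan_subspaces_at (s : 'End(g)) (X : g) : set {vspace g} :=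
  [set a | cartan_subspace s a /\ X \in a].

Definition isotropy (H : set G) (X : g) : set G := [set x | H x /\ Ad x X = X].

Definition isotropy_conjugate (H : set G) (X : g) (a b : {vspace g}) :=
  exists2 x, isotropy H X x & Ad x @` [set` a] = [set` b].

(* Each isotropy class of CS_X contains exactly one of the a i. *)
Definition complete_representatives (s : 'End(g)) (H : set G) (X : g) (m : nat)
    (a : 'I_m -> {vspace g}) :=
  (forall i, cartan_subspaces_at s X (a i)) /\
  (forall b, cartan_subspaces_at s X b ->
    exists! i, isotropy_conjugate H X (a i) b).

End Symmetric.

(* Main.v *)
(* Unitary trick.  Only the compact dual u = k + i p of g = k + p matters, where
   k and p are the eigenspaces of theta; through x_k + x_p |-> x_k + i x_p it is
   carried by g itself, with a twisted bracket [dual_lie] and the invariant inner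
   product -B(x, theta y).  A theta-invariant Cartan subspace a is its own
   centralizer in q, because the k- and p-parts of an element of q commuting
   with a are semisimple and can be added to a.  Hence a_i and a_j become maximal
   abelian subspaces of the (-1)-eigenspace of s in u.  They are conjugate by an
   automorphism of u commuting with s and fixing the k- and p-parts of X: the
   group K of such automorphisms is compact, and where f |-> <f x, y> is maximal
   on K one has [f x, y] = 0.  The C-linear extension of this automorphism to
   u^C = g^C preserves the Killing form and fixes X. *)
Require Import Defs.
From HB Require Import structures.
From mathcomp Require Import all_boot all_order all_algebra.
From mathcomp Require Import all_classical all_reals all_analysis.
From mathcomp Require Import complex ring lra.

Set Implicit Arguments.
Unset Strict Implicit.
Unset Printing Implicit Defensive.

Import Order.TTheory GRing.Theory Num.Theory numFieldNormedType.Exports.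
Import passmx.

Local Open Scope classical_set_scope.
Local Open Scope ring_scope.

(** * Inner product spaces and the flow of a skew map *)

Section InnerProduct.
Variables (R : realType) (V : vectType R).
Implicit Types (x y z : V) (dot : V -> V -> R).

Definition inner_product dot :=
  [/\ forall x y, dot x y = dot y x,
      forall y, scalar (dot^~ y) &
      forall x, x != 0 -> 0 < dot x x].

Variables (dot : V -> V -> R) (dotP : inner_product dot).

Lemma dotC x y : dot x y = dot y x. Proof. by case: dotP. Qed.

Lemma dotDl x y z : dot (x + y) z = dot x z + dot y z.
Proof. by case: dotP => _ /(_ z 1 x y) + _; rewrite scale1r mul1r. Qed.

Lemma dot0l z : dot 0 z = 0.
Proof. by apply: (addrI (dot 0 z)); rewrite -dotDl !addr0. Qed.

Lemma dotZl a x z : dot (a *: x) z = a * dot x z.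
Proof. by case: dotP => _ /(_ z a x 0) + _; rewrite !addr0 dot0l addr0. Qed.

Lemma dotNl x z : dot (- x) z = - dot x z.
Proof. by rewrite -scaleN1r dotZl mulN1r. Qed.

Lemma dotBl x y z : dot (x - y) z = dot x z - dot y z.
Proof. by rewrite dotDl dotNl. Qed.

Lemma dotDr z x y : dot z (x + y) = dot z x + dot z y.
Proof. by rewrite !(dotC z) dotDl. Qed.

Lemma dotZr z a x : dot z (a *: x) = a * dot z x.
Proof. by rewrite !(dotC z) dotZl. Qed.

Lemma dotNr z x : dot z (- x) = - dot z x.
Proof. by rewrite !(dotC z) dotNl. Qed.

Lemma dot_suml I (r : seq I) (P : pred I) (F : I -> V) z :
  dot (\sum_(i <- r | P i) F i) z = \sum_(i <- r | P i) dot (F i) z.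
Proof. exact: (big_morph (dot^~ z) (fun x y => dotDl x y z) (dot0l z)). Qed.

Lemma dot_sumr I (r : seq I) (P : pred I) (F : I -> V) z :
  dot z (\sum_(i <- r | P i) F i) = \sum_(i <- r | P i) dot z (F i).
Proof. by rewrite dotC dot_suml; apply: eq_bigr => i _; rewrite dotC. Qed.

Lemma dot_eq0 x : dot x x = 0 -> x = 0.
Proof.
by case: dotP => _ _ pos x0; apply/eqP/negPn/negP => /pos; rewrite x0 ltxx.
Qed.

Lemma dot_inj x y : (forall z, dot x z = dot y z) -> x = y.
Proof.
by move=> xy; apply/eqP; rewrite -subr_eq0; apply/eqP/dot_eq0; rewrite dotBl xy subrr.
Qed.

Definition orthonormal n (e : 'I_n -> V) :=
  forall i j, dot (e i) (e j) = (i == j)%:R.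

Lemma orthonormal_free n (e : 'I_n -> V) : orthonormal e ->
  free [tuple e i | i < n].
Proof.
move=> eo; apply/freeP => k k0 i.
have := congr1 (dot^~ (e i)) k0; rewrite dot0l dot_suml (bigD1 i)//= big1.
  by rewrite addr0 dotZl nth_mktuple eo eqxx mulr1.
by move=> j ji; rewrite dotZl nth_mktuple eo (negbTE ji) mulr0.
Qed.

(** Gram-Schmidt, one vector at a time: a vector outside the span is projected and normalized, and
    becomes the last member [ord_max] of the family. The case [n = \dim {:V}] supplies orthonormal
    bases. *)
Lemma exists_orthonormal n : (n <= \dim {:V})%N ->
  exists e : 'I_n -> V, orthonormal e.
Proof.
elim: n => [|n IHn] n_le; first by exists (fun=> 0) => -[].
have [e eo] := IHn (ltnW n_le).
have [v ve] : exists v, v \notin <<[tuple e i | i < n]>>%VS.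
  apply: contrapT => /forallNP ve; move: n_le; rewrite ltnNge => /negP; apply.
  rewrite -[X in (_ <= X)%N](size_tuple [tuple e i | i < n]).
  apply: leq_trans (dim_span _); apply: dimvS; apply/subvP => x _.
  by apply/negPn/negP/ve.
pose y := v - \sum_i dot v (e i) *: e i.
have y_neq0 : y != 0.
  apply: contra ve; rewrite subr_eq0 => /eqP->; apply: memv_suml => i _.
  by apply/memvZ/memv_span/map_f; rewrite mem_enum.
have y_e i : dot y (e i) = 0.
  rewrite dotBl dot_suml (bigD1 i)//= big1 ?addr0 ?dotZl ?eo ?eqxx ?mulr1 ?subrr//.
  by move=> j ji; rewrite dotZl eo (negbTE ji) mulr0.
have y_gt0 : 0 < dot y y by case: dotP => _ _; apply.
pose u := (Num.sqrt (dot y y))^-1 *: y.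
have uu : dot u u = 1.
  rewrite dotZl dotZr mulrA -invfM -expr2 sqr_sqrtr ?(ltW y_gt0)// mulVf//.
  by rewrite gt_eqF.
exists (fun i => if unlift ord_max i is Some j then e j else u) => i j.
case: (unliftP ord_max i) => [i'|] ->; case: (unliftP ord_max j) => [j'|] ->.
- by rewrite eo (inj_eq lift_inj).
- by rewrite dotC dotZl y_e mulr0 eq_sym (negbTE (neq_lift _ _)).
- by rewrite dotZl y_e mulr0 (negbTE (neq_lift _ _)).
- by rewrite uu eqxx.
Qed.

Lemma orthonormal_sum (e : 'I_(\dim {:V}) -> V) x : orthonormal e ->
  x = \sum_i dot x (e i) *: e i.
Proof.
move=> eo; have xe : x \in <<[tuple e i | i < \dim {:V}]>>%VS.
  have -> : <<[tuple e i | i < \dim {:V}]>>%VS = fullv; last exact: memvf.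
  apply/eqP; rewrite eqEdim subvf /=.
  by have /eqP -> := orthonormal_free eo; rewrite size_tuple.
rewrite {1}(coord_span xe); apply: eq_bigr => i _.
rewrite nth_mktuple; congr (_ *: _).
rewrite {2}(coord_span xe) dot_suml (bigD1 i)//= big1.
  by rewrite addr0 dotZl nth_mktuple eo eqxx mulr1.
by move=> j ji; rewrite dotZl nth_mktuple eo (negbTE ji) mulr0.
Qed.

Lemma dot_orthonormal (e : 'I_(\dim {:V}) -> V) x y : orthonormal e ->
  dot x y = \sum_i dot x (e i) * dot y (e i).
Proof.
move=> eo; rewrite {1}(orthonormal_sum y eo) dot_sumr.
by apply: eq_bigr => i _; rewrite dotZr mulrC.
Qed.

(* Derivatives of curves in V are taken weakly, so that V needs no topology. *)
Definition is_derivative (w w' : R -> V) :=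
  forall z (t : R), is_derive t (1 : R) (fun u => dot (w u) z) (dot (w' t) z).

(** Weak derivatives differentiate each coordinate in an orthonormal basis, so the product rule
    holds coordinatewise and sums up. *)
Lemma is_derivative_dot (v v' w w' : R -> V) (t : R) :
  is_derivative v v' -> is_derivative w w' ->
  is_derive t (1 : R) (fun u => dot (v u) (w u)) (dot (v' t) (w t) + dot (v t) (w' t)).
Proof.
move=> dv dw; have [e eo] := exists_orthonormal (leqnn _).
have -> : (fun u => dot (v u) (w u)) =
    \sum_i (fun u => dot (v u) (e i) * dot (w u) (e i)).
  by apply/funext => u; rewrite fct_sumE; exact: dot_orthonormal.
rewrite (dot_orthonormal (v' t) _ eo) (dot_orthonormal (v t) _ eo) -big_split /=.
apply: is_derive_sum => i.
apply: (is_derive_eq (is_deriveM (dv (e i) t) (dw (e i) t))).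
by rewrite /GRing.scale /= addrC mulrC [in X in _ + X]mulrC; ring.
Qed.

Lemma is_derivativeB (v v' w w' : R -> V) :
  is_derivative v v' -> is_derivative w w' ->
  is_derivative (fun t => v t - w t) (fun t => v' t - w' t).
Proof.
move=> dv dw z t; rewrite dotBl.
have -> : (fun u => dot (v u - w u) z) =
    (fun u => dot (v u) z) - (fun u => dot (w u) z).
  by apply/funext => u; rewrite dotBl.
by apply: is_deriveB; [exact: dv|exact: dw].
Qed.

Lemma is_derivative_cst x : is_derivative (fun=> x) (fun=> 0).
Proof. by move=> z t; rewrite dot0l; exact: is_derive_cst. Qed.

Section Skew.
Variable D : V -> V.
Hypothesis D_skew : forall x y, dot (D x) y = - dot x (D y).

Lemma skew_dot0 x : dot (D x) x = 0.
Proof. by have := D_skew x x; rewrite [dot x _]dotC; lra. Qed.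

(** The derivative of [dot (w t) (w t)] is twice [dot (D (w t)) (w t)], which skewness annihilates;
    so the norm keeps its initial value 0. *)
Lemma skew_ode_unique (w : R -> V) :
  is_derivative w (fun t => D (w t)) -> w 0 = 0 -> forall t, w t = 0.
Proof.
move=> dw w0 t; apply: dot_eq0.
have d0 u : is_derive u (1 : R) (fun u => dot (w u) (w u)) 0.
  apply: is_derive_eq (is_derivative_dot u dw dw) _.
  by rewrite skew_dot0 dotC skew_dot0 addr0.
by rewrite (is_derive_0_is_cst t 0 d0) w0 dot0l.
Qed.
End Skew.

End InnerProduct.

(** * The flow of a skew map as an exponential series *)

Section SkewFlow.
Variables (R : realType) (V : vectType R) (dot : V -> V -> R).
Hypothesis dotP : inner_product dot.
Variable D : V -> V.
Hypothesis D_skew : forall x y, dot (D x) y = - dot x (D y).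
Implicit Types x y z : V.

(** Skewness moves [D] onto the basis vectors. The l1 norm [N] of the coordinates therefore grows at
    each application of [D] by at most the factor [M], the sum of the [N (D (e i))]. *)
Lemma dot_iter_bound : exists M, forall x z, exists A,
  forall k, `|dot (iter k D x) z| <= A * M ^+ k.
Proof.
have [e eo] := exists_orthonormal dotP (leqnn _).
pose N x := \sum_i `|dot x (e i)|.
have dot_le x z : `|dot x z| <= N x * N z.
  rewrite (dot_orthonormal dotP x z eo) (le_trans (ler_norm_sum _ _ _))//.
  rewrite mulr_suml ler_sum// => i _; rewrite normrM ler_wpM2l//.
  by rewrite /N (bigD1 i)//= lerDl sumr_ge0.
pose M := \sum_i N (D (e i)); exists M => x z.
have N_ge0 y : 0 <= N y by exact: sumr_ge0.
have ND y : N (D y) <= N y * M.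
  apply: (@le_trans _ _ (\sum_i N y * N (D (e i)))); last by rewrite mulr_sumr.
  by apply: ler_sum => i _; rewrite D_skew normrN; exact: dot_le.
exists (N x * N z) => k; rewrite (le_trans (dot_le _ _))// mulrAC ler_wpM2r//.
elim: k => [|k IHk]; first by rewrite mulr1.
rewrite iterS exprSr mulrA (le_trans (ND _))// ler_wpM2r//.
exact: sumr_ge0.
Qed.

(** Taylor coefficients of the function sending [t] to the inner product of exp(tD) x with [z]. *)
Let c x z k := dot (iter k D x) z / k`!%:R.

Lemma is_cvg_flow_series x z t : cvgn (pseries (c x z) t).
Proof.
have [M /(_ x z)[A cA]] := dot_iter_bound.
have A_ge0 : 0 <= A by have := cA 0%N; rewrite mulr1; exact: le_trans.
have [->|t0] := eqVneq t 0.
  apply: (cvgP (c x z 0%N)); apply: cvg_near_cst.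
  near=> n; rewrite /pseries /series /=.
  (* At [t = 0] the partial sums are constant once they contain the term of index 0. *)
  have -> : n = n.-1.+1 by rewrite prednK//; near: n; exact: nbhs_infty_gt.
  rewrite big_nat_recl//= big1 ?addr0 ?mulr1// => i _.
  by rewrite exprS mul0r mulr0.
apply: normed_cvg.
apply: (@series_le_cvg _ _ (fun k => A * exp_coeff (`|M| * `|t|) k)).
- by move=> n /=.
- by move=> n; rewrite mulr_ge0// exp_coeff_ge0// mulr_ge0.
- move=> n /=; rewrite /exp_coeff /= !normrM normfV normrX.
  rewrite (ger0_norm (ler0n R n`!)) exprMn.
  rewrite mulrAC !mulrA ler_wpM2r ?invr_ge0// ler_wpM2r ?exprn_ge0//.
  apply: le_trans (cA n) _; rewrite ler_wpM2l// -normrX.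
  exact: ler_norm.
- by apply: is_cvg_seriesZ; exact: is_cvg_series_exp_coeff.
Unshelve. all: by end_near.
Qed.

Let S x z t := limn (pseries (c x z) t).

(** The factor [k.+1] of a formal derivative cancels against the factorial, leaving one more [D] on
    [x]; this is where the differential equation of the flow comes from. *)
Let c_diffs x z : pseries_diffs (c x z) = c (D x) z.
Proof.
apply/funext => k; rewrite /pseries_diffs /c -iterSr factS natrM invfM.
by rewrite mulrCA mulVKf.
Qed.

Let S_derive x z t : is_derive t (1 : R) (S x z) (S (D x) z t).
Proof.
(* Termwise differentiation at [t] asks for convergence at some point of larger modulus; the series
   converges everywhere. *)
rewrite /S -c_diffs; apply: (@pseries_snd_diffs _ _ (`|t| + 1)).
- exact: is_cvg_flow_series.
- by rewrite c_diffs; exact: is_cvg_flow_series.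
- by rewrite !c_diffs; exact: is_cvg_flow_series.
- by rewrite [ltRHS]ger0_norm ?addr_ge0// ltrDl.
Qed.

Let SZD x a y z t : S x (a *: y + z) t = a * S x y t + S x z t.
Proof.
apply: cvg_lim => //.
have -> : pseries (c x (a *: y + z)) t =
    (fun n => a * pseries (c x y) t n + pseries (c x z) t n).
  apply/funext => n; rewrite /pseries /series /= mulr_sumr -big_split /=.
  apply: eq_bigr => k _; rewrite /c (dotDr dotP) (dotZr dotP); ring.
apply: cvgD; last exact: is_cvg_flow_series.
by apply: cvgM; [exact: cvg_cst|exact: is_cvg_flow_series].
Qed.

Let S0 x z : S x z 0 = dot x z.
Proof.
apply: cvg_lim => //; apply: cvg_near_cst.
near=> n; rewrite /pseries /series /=.
have -> : n = n.-1.+1 by rewrite prednK//; near: n; exact: nbhs_infty_gt.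
rewrite big_nat_recl//= big1 ?addr0 ?mulr1 /c/= ?divr1// => i _.
by rewrite exprS mul0r mulr0.
Unshelve. all: by end_near.
Qed.

(** [F t x] is the vector that represents the linear form sending [z] to [S x z t]; it is built from
    its coordinates in an orthonormal basis. *)
Lemma skew_flow : exists F : R -> V -> V,
  (forall x, F 0 x = x) /\
  (forall x, is_derivative dot (F^~ x) (fun t => D (F t x))).
Proof.
have [e eo] := exists_orthonormal dotP (leqnn _).
pose F t x := \sum_i S x (e i) t *: e i.
have Sz0 x t : S x 0 t = 0.
  by have := SZD x 1 0 0 t; rewrite scaler0 addr0 mul1r; lra.
have SZ x a z t : S x (a *: z) t = a * S x z t.
  by rewrite -[a *: z]addr0 SZD Sz0 addr0.
have FE t x z : dot (F t x) z = S x z t.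
  rewrite {2}(orthonormal_sum dotP z eo) (dot_suml dotP).
  rewrite (big_morph (fun z => S x z t) (id1 := 0) (op1 := +%R)); first last.
  - exact: Sz0.
  - by move=> y y'; rewrite -[y in LHS]scale1r SZD mul1r.
  apply: eq_bigr => i _; rewrite (dotZl dotP) (dotC dotP).
  by rewrite SZ mulrC.
exists F; split=> [x|x z t].
  by apply: (dot_inj dotP) => z; rewrite FE S0.
rewrite D_skew FE.
(* By skewness each iterate carries the extra [D] from [z] back to [x]. *)
have -> : - S x (D z) t = S (D x) z t.
  have -> : - S x (D z) t = S x (- D z) t.
    by rewrite -(scaleN1r (D z)) SZ mulN1r.
  rewrite /S (_ : c x (- D z) = c (D x) z)//; apply/funext => k; rewrite /c.
  by rewrite (dotNr dotP) -D_skew -iterS iterSr.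
have -> : (fun u => dot (F u x) z) = S x z by apply/funext => u; exact: FE.
exact: S_derive.
Qed.

End SkewFlow.

(** * Conjugacy in a Lie algebra with an invariant inner product *)

Section ClosedSets.
Variables (R : realType) (T : topologicalType).

Lemma closed_eq_fun (f g : T -> R) : continuous f -> continuous g ->
  closed [set t | f t = g t].
Proof.
move=> cf cg; rewrite (_ : mkset _ = (fun t => f t - g t) @^-1` [set 0]).
  apply: preimage_closed; last exact: closed_eq.
  by move=> t _; apply: cvgB; [exact: cf|exact: cg].
apply/seteqP; split=> t /= => [->|/eqP]; first by rewrite subrr.
by rewrite subr_eq0 => /eqP.
Qed.

Lemma closed_forall (I : Type) (P : I -> set T) :
  (forall i, closed (P i)) -> closed [set t | forall i, P i t].
Proof.
move=> Pc; rewrite (_ : mkset _ = \bigcap_(i in setT) P i).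
  by apply: closed_bigI => i _; exact: Pc.
by apply/seteqP; split=> t Pt i => [_|]; exact: Pt.
Qed.

Lemma continuous_mulr (f g : T -> R) : continuous f -> continuous g ->
  continuous (fun t => f t * g t).
Proof. by move=> cf cg t; apply: cvgM; [exact: cf|exact: cg]. Qed.

Lemma continuous_sumr n (h : 'I_n -> T -> R) :
  (forall i, continuous (h i)) -> continuous (fun t => \sum_i h i t).
Proof. by move=> ch; apply: continuous_big => // ; exact: add_continuous. Qed.
End ClosedSets.

Section CompactLie.
Variables (R : realType) (V : vectType R) (dot : V -> V -> R).
Hypothesis dotP : inner_product dot.
Variables (br : V -> V -> V) (s : V -> V).
Hypothesis brC : forall x y, br x y = - br y x.
Hypothesis br_jacobi : forall x y z,
  br x (br y z) + br y (br z x) + br z (br x y) = 0.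
Hypothesis br_dot : forall x y z, dot (br x y) z = dot x (br y z).
Hypothesis s_br : forall x y, s (br x y) = br (s x) (s y).
Hypothesis s_dot : forall x y, dot (s x) (s y) = dot x y.
Hypothesis sK : forall x, s (s x) = x.
Implicit Types (x y z : V) (a b c : {vspace V}).

Lemma brDl x y z : br (x + y) z = br x z + br y z.
Proof.
apply: (dot_inj dotP) => w.
by rewrite (dotDl dotP) !br_dot (dotDl dotP).
Qed.

Lemma brNl x z : br (- x) z = - br x z.
Proof.
apply: (dot_inj dotP) => w.
by rewrite (dotNl dotP) !br_dot (dotNl dotP).
Qed.

Lemma brZl k x z : br (k *: x) z = k *: br x z.
Proof.
apply: (dot_inj dotP) => w.
by rewrite (dotZl dotP) !br_dot (dotZl dotP).
Qed.

Lemma brDr z x y : br z (x + y) = br z x + br z y.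
Proof. by rewrite !(brC z) brDl opprD. Qed.

Lemma brNr z x : br z (- x) = - br z x.
Proof. by rewrite brC brNl -brC. Qed.

Lemma brZr k z x : br z (k *: x) = k *: br z x.
Proof. by rewrite !(brC z) brZl scalerN. Qed.

Lemma brxx x : br x x = 0.
Proof.
have /eqP := brC x x; rewrite -subr_eq0 opprK -mulr2n -scaler_nat.
by rewrite scaler_eq0 pnatr_eq0 => /eqP.
Qed.

Lemma s_dotr x y : dot (s x) y = dot x (s y).
Proof. by rewrite -[y in LHS]sK s_dot. Qed.

(** Linearity follows from the first clause by [dot_preserving_linear], so these maps form a group
    of orthogonal transformations. *)
Definition compact_aut c (f : V -> V) :=
  [/\ forall x y, dot (f x) (f y) = dot x y,
      forall x y, f (br x y) = br (f x) (f y),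
      forall x, f (s x) = s (f x) &
      forall x, x \in c -> f x = x].

(** The squared norm of the defect of linearity expands into inner products of values of [f].
    Replacing each by the inner product of the arguments gives 0. *)
Lemma dot_preserving_linear (f : V -> V) :
  (forall x y, dot (f x) (f y) = dot x y) -> linear f.
Proof.
move=> fdot k x y; apply/eqP; rewrite -subr_eq0; apply/eqP/(dot_eq0 dotP).
rewrite !(dotBl dotP) !(dotDl dotP) !(dotZl dotP) [dot (f _) (_ - _)](dotC dotP).
rewrite [dot (f x) (_ - _)](dotC dotP) [dot (f y) (_ - _)](dotC dotP).
rewrite !(dotBl dotP) !(dotDl dotP) !(dotZl dotP) !fdot.
rewrite !(dotDr dotP, dotDl dotP, dotZr dotP, dotZl dotP) (dotC dotP y x); ring.
Qed.

Lemma compact_aut_id c : compact_aut c id. Proof. by []. Qed.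

Lemma compact_aut_comp c f h :
  compact_aut c f -> compact_aut c h -> compact_aut c (f \o h).
Proof.
move=> [fd fb fs fc] [hd hb hs hc]; split=> [x y|x y|x|x xc] /=.
- by rewrite fd hd.
- by rewrite hb fb.
- by rewrite hs fs.
- by rewrite hc// fc.
Qed.

Lemma compact_aut_sub a c f : (c <= a)%VS -> compact_aut a f -> compact_aut c f.
Proof.
by move=> /subvP ca [fd fb fs fa]; split=> // x /ca; exact: fa.
Qed.

(** [F t] is exp(t ad z). Inner products are constant along it since ad z is skew. The other three
    clauses come from [skew_ode_unique]: the difference of both sides solves w' = [z, w] and
    vanishes at 0, by Jacobi for the bracket, by [s z = z] for [s], and by [z, x] = 0 on [c]. *)
Lemma compact_aut_flow c z : s z = z -> (forall x, x \in c -> br z x = 0) ->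
  exists F : R -> V -> V,
    [/\ forall t, compact_aut c (F t), forall x, F 0 x = x &
        forall x, is_derivative dot (F^~ x) (fun t => br z (F t x))].
Proof.
move=> sz zc; have z_skew x y : dot (br z x) y = - dot x (br z y).
  by rewrite brC (dotNl dotP) br_dot.
have [F [F0 dF]] := skew_flow dotP z_skew.
exists F; split=> // t; split=> [x y|x y|x|x xc].
- have d0 u : is_derive u (1 : R) (fun u => dot (F u x) (F u y)) 0.
    apply: is_derive_eq (is_derivative_dot dotP u (dF x) (dF y)) _.
    by rewrite z_skew addNr.
  by rewrite (is_derive_0_is_cst t 0 d0) !F0.
- have dbr : is_derivative dot (fun t => br (F t x) (F t y))
      (fun t => br (br z (F t x)) (F t y) + br (F t x) (br z (F t y))).
    move=> w u; rewrite (dotDl dotP) !br_dot.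
    have -> : (fun u => dot (br (F u x) (F u y)) w) =
        (fun u => dot (F u x) (br (F u y) w)).
      by apply/funext => v; rewrite br_dot.
    have dy : is_derivative dot (fun t => br (F t y) w) (fun t => br (br z (F t y)) w).
      move=> p v; rewrite br_dot.
      have -> : (fun u => dot (br (F u y) w) p) = (fun u => dot (F u y) (br w p)).
        by apply/funext => v'; rewrite br_dot.
      exact: dF.
    by have := is_derivative_dot dotP u (dF x) dy; rewrite br_dot.
  apply/eqP; rewrite -subr_eq0; apply/eqP.
  apply: (skew_ode_unique dotP z_skew (w := fun t => F t (br x y) - br (F t x) (F t y))).
    have := is_derivativeB dotP (dF (br x y)) dbr.
    congr is_derivative; apply/funext => u; rewrite brDr brNr; congr (_ - _).
    have := br_jacobi z (F u x) (F u y).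
    rewrite (brC (F u y) z) brNr (brC (F u y) (br _ _)) => /eqP.
    by rewrite -addrA -opprD subr_eq0 => /eqP ->; rewrite addrC.
  by rewrite !F0 subrr.
- apply/eqP; rewrite -subr_eq0; apply/eqP.
  apply: (skew_ode_unique dotP z_skew (w := fun t => F t (s x) - s (F t x))).
    have ds : is_derivative dot (fun t => s (F t x)) (fun t => s (br z (F t x))).
      move=> w u; rewrite s_dotr.
      by under eq_fun do rewrite s_dotr; exact: dF.
    rewrite (_ : (fun t => br z _) = (fun t => br z (F t (s x)) - s (br z (F t x)))).
      exact: (is_derivativeB dotP (dF (s x)) ds).
    by apply/funext => u; rewrite s_br sz brDr brNr.
  by rewrite !F0 subrr.
- apply/eqP; rewrite -subr_eq0; apply/eqP.
  apply: (skew_ode_unique dotP z_skew (w := fun t => F t x - x)).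
    rewrite (_ : (fun t => br z _) = (fun t => br z (F t x) - 0)).
      exact: (is_derivativeB dotP (dF x) (is_derivative_cst dotP x)).
    by apply/funext => u; rewrite brDr brNr (zc x xc).
  by rewrite !F0 subrr.
Qed.

(** * Compactness of the automorphism group, in matrix coordinates *)

Section Maximum.
Variable e : 'I_(\dim {:V}) -> V.
Hypothesis eo : orthonormal dot e.
Let N := \dim {:V}.

(** The linear map with a given matrix in the basis [e]. The matrix is flattened to a row vector,
    the form in which [rV_compact] and [EVT_max_rV] are stated. *)
Definition of_coords (m : 'rV[R]_(N * N)) x :=
  \sum_i \sum_j (dot x (e i) * m 0 (mxvec_index i j)) *: e j.

Lemma dot_of_coords m x z : dot (of_coords m x) z =
  \sum_i \sum_j dot x (e i) * m 0 (mxvec_index i j) * dot (e j) z.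
Proof.
rewrite /of_coords (dot_suml dotP); apply: eq_bigr => i _.
by rewrite (dot_suml dotP); apply: eq_bigr => j _; rewrite (dotZl dotP).
Qed.

Lemma continuous_of_coords x z : continuous (fun m => dot (of_coords m x) z).
Proof.
under eq_fun do rewrite dot_of_coords.
apply: continuous_sumr => i.
apply: continuous_sumr => j.
apply: continuous_mulr; last exact: cst_continuous.
by apply: continuous_mulr; [exact: cst_continuous|exact: coord_continuous].
Qed.

Lemma compact_aut_of_coords c f : compact_aut c f ->
  exists m, of_coords m = f.
Proof.
move=> [/dot_preserving_linear fl _ _ _].
pose f' : {linear V -> V} := HB.pack f (GRing.isLinear.Build _ _ _ _ f fl).
exists (mxvec (\matrix_(i, j) dot (f (e i)) (e j))); apply/funext => x.
rewrite -[f]/(f' : V -> V) {2}(orthonormal_sum dotP x eo) linear_sum.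
apply: eq_bigr => i _; rewrite linearZ /=.
rewrite [in RHS](orthonormal_sum dotP (f (e i)) eo) scaler_sumr.
by apply: eq_bigr => j _; rewrite mxvecE mxE scalerA.
Qed.

(** Tested against arbitrary vectors, each clause becomes a family of equations between continuous
    real functions of [m]. *)
Lemma closed_compact_aut c : closed [set m | compact_aut c (of_coords m)].
Proof.
rewrite (_ : mkset _ =
    [set m | forall x y, dot (of_coords m x) (of_coords m y) = dot x y] `&`
    [set m | forall x y z, dot (of_coords m (br x y)) z =
                           dot (br (of_coords m x) (of_coords m y)) z] `&`
    [set m | forall x z, dot (of_coords m (s x)) z = dot (s (of_coords m x)) z] `&`
    [set m | forall x (_ : x \in c) z, dot (of_coords m x) z = dot x z]).
  apply: closedI; first apply: closedI; first apply: closedI.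
  - apply: closed_forall => x; apply: closed_forall => y.
    apply: closed_eq_fun; last exact: cst_continuous.
    under eq_fun do rewrite (dot_orthonormal dotP _ _ eo).
    apply: continuous_sumr => i.
    by apply: continuous_mulr; exact: continuous_of_coords.
  - apply: closed_forall => x; apply: closed_forall => y; apply: closed_forall => z.
    apply: closed_eq_fun; first exact: continuous_of_coords.
    under eq_fun do rewrite br_dot (dot_orthonormal dotP _ _ eo).
    apply: continuous_sumr => i.
    apply: continuous_mulr; first exact: continuous_of_coords.
    by under eq_fun do rewrite br_dot; exact: continuous_of_coords.
  - apply: closed_forall => x; apply: closed_forall => z.
    apply: closed_eq_fun; first exact: continuous_of_coords.
    by under eq_fun do rewrite s_dotr; exact: continuous_of_coords.
  - apply: closed_forall => x; apply: closed_forall => xc; apply: closed_forall => z.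
    apply: closed_eq_fun; first exact: continuous_of_coords.
    exact: cst_continuous.
apply/seteqP; split=> m /=.
  case=> md mb ms mc; split; last by move=> x xc z; rewrite mc.
  split; last by move=> x z; rewrite ms.
  by split=> // x y z; rewrite mb.
move=> [[[md mb] ms] mc]; split=> // [x y|x|x xc]; apply: (dot_inj dotP) => z.
- by rewrite mb.
- by rewrite ms.
- by rewrite mc.
Qed.

(** The rows of an orthogonal matrix are unit vectors, so all entries lie in [-1, 1]; a closed
    subset of this box is compact. *)
Lemma compact_compact_aut c : compact [set m | compact_aut c (of_coords m)].
Proof.
have box := @rV_compact R (N * N) (fun=> `[- 1, 1]%classic)
  (fun=> @segment_compact R (- 1) 1).
apply: subclosed_compact (@closed_compact_aut c) box _.
move=> m [md _ _ _] k; case/mxvec_indexP: k => i j /=.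
have -> : m 0 (mxvec_index i j) = dot (of_coords m (e i)) (e j).
  rewrite dot_of_coords (bigD1 i)//= [X in _ + X]big1 ?addr0.
    rewrite (bigD1 j)//= big1 ?addr0 ?eo ?eqxx ?mul1r ?mulr1// => k kj.
    by rewrite !eo (negbTE kj) mulr0.
  move=> k ki; rewrite big1// => l _.
  by rewrite eo eq_sym (negbTE ki) !mul0r.
rewrite in_itv /= -ler_norml -(ler_pXn2r (n := 2))// ?nnegrE// expr1n.
rewrite real_normK ?num_real//.
have := md (e i) (e i); rewrite eo eqxx mulr1n (dot_orthonormal dotP _ _ eo) => <-.
by rewrite (bigD1 j)//= -expr2 lerDl sumr_ge0// => k _; rewrite -expr2 sqr_ge0.
Qed.
End Maximum.

Lemma exists_max_aut c x y : exists2 f, compact_aut c f &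
  forall h, compact_aut c h -> dot (h x) y <= dot (f x) y.
Proof.
have [e eo] := exists_orthonormal dotP (leqnn _).
have [m0 m0E] := compact_aut_of_coords eo (compact_aut_id c).
have [||m] := EVT_max_rV _ (@compact_compact_aut e eo c)
    (f := fun m => dot (of_coords e m x) y).
- by exists m0 => /=; rewrite m0E; exact: compact_aut_id.
- by apply: continuous_subspaceT; exact: continuous_of_coords.
rewrite inE => mc mM; exists (of_coords e m) => // h hc.
have [m' m'E] := compact_aut_of_coords eo hc.
by have := mM m'; rewrite inE /= m'E; apply.
Qed.

(* At a maximum f of <f x, y>, the flow of z = [f x, y] has derivative <z, z>. *)
Lemma commuting_translate c x y : s x = - x -> s y = - y ->
  (forall w, w \in c -> br w x = 0) -> (forall w, w \in c -> br w y = 0) ->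
  exists2 f, compact_aut c f & br (f x) y = 0.
Proof.
move=> sx sy cx cy; have [f fc fM] := exists_max_aut c x y.
exists f => //; set z := br (f x) y; have [fd fb fs ff] := fc.
have f0 : f 0 = 0 by apply: (dot_eq0 dotP); rewrite fd (dot0l dotP).
have fN u : f (- u) = - f u.
  have := dot_preserving_linear fd (- 1) u 0.
  by rewrite f0 !addr0 !scaleN1r.
(* By Jacobi [z] commutes with [c], and [s z = z] because [f x] and [y] are both negated by [s];
   hence the flow of [z] stays in the group. *)
have zc w : w \in c -> br z w = 0.
  move=> wc; have cfx : br w (f x) = 0.
    by have /(congr1 f) := cx _ wc; rewrite fb ff// f0.
  have := br_jacobi w (f x) y; rewrite (brC y w) (cy w wc) cfx.
  have br0 u : br u 0 = 0 by rewrite -{1}(subrr u) brDr brNr subrr.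
  by rewrite oppr0 !br0 !addr0 => wz; rewrite brC wz oppr0.
have sz : s z = z.
  by rewrite s_br -fs sx sy fN brNl brNr opprK.
have [F [Fc F0 dF]] := compact_aut_flow sz zc.
have dz := dF (f x) y 0; rewrite F0 br_dot -/z in dz.
have d0 : is_derive (0 : R) (1 : R) (fun u => dot (F u (f x)) y) 0.
  (* The bound [fM] holds at every time, so any open interval around 0 serves. *)
  apply: (@derive1_at_max _ _ (- 1) 1); first by lra.
  - by move=> t _; have [] := dF (f x) y t.
  - by rewrite in_itv /=; lra.
  - by move=> t _; rewrite F0; exact: (fM _ (compact_aut_comp (Fc t) fc)).
by apply: (dot_eq0 dotP); rewrite -(@derive_val _ _ _ _ _ _ _ dz) derive_val.
Qed.

(** * Maximal abelian subspaces of the minus eigenspace and their conjugacy *)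

Definition abelian_in_minus a :=
  (forall x, x \in a -> s x = - x) /\
  (forall x y, x \in a -> y \in a -> br x y = 0).

(** Maximality is phrased as being self-centralizing in the (-1)-eigenspace of [s]. *)
Definition flat a := abelian_in_minus a /\
  forall z, s z = - z -> (forall x, x \in a -> br x z = 0) -> z \in a.

Lemma s_linear : linear s. Proof. exact: dot_preserving_linear. Qed.

Lemma abelian_in_minus_add a z : abelian_in_minus a -> s z = - z ->
  (forall x, x \in a -> br x z = 0) -> abelian_in_minus (a + <[z]>)%VS.
Proof.
move=> [am ab] zm za; split=> [_ /memv_addP[x xa [_ /vlineP[k ->] ->]]|].
  by rewrite addrC s_linear zm am// scalerN opprD.
move=> _ _ /memv_addP[x xa [_ /vlineP[k ->] ->]] /memv_addP[y ya [_ /vlineP[l ->] ->]].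
rewrite brDl !brDr !brZl !brZr brxx (ab x y xa ya) (za x xa) (brC z y) (za y ya).
by rewrite oppr0 !scaler0 !addr0.
Qed.

(** The decreasing measure for the inductions of [exists_flat] and [flat_conjugate]. *)
Lemma codim_add_line a z : z \notin a ->
  (\dim {:V} - \dim (a + <[z]>) < \dim {:V} - \dim a)%N.
Proof.
move=> za; have lt_a : (\dim a < \dim (a + <[z]>))%N.
  rewrite ltn_neqAle dimvS ?addvSl// andbT; apply: contra za => /eqP d.
  have /eqP -> : a == (a + <[z]>)%VS by rewrite eqEdim addvSl d leqnn.
  by rewrite -{1}[z]add0r memv_add ?mem0v ?memv_line.
apply: ltn_sub2l => //; apply: leq_trans lt_a _; exact/dimvS/subvf.
Qed.

Lemma exists_flat a : abelian_in_minus a -> exists2 b, flat b & (a <= b)%VS.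
Proof.
have [k] := ubnP (\dim {:V} - \dim a); elim: k a => // k IHk a ak aP.
have [[z [zm za z_a]]|noz] := pselect (exists z,
    [/\ s z = - z, forall x, x \in a -> br x z = 0 & z \notin a]).
  have [||b bf ab] := IHk (a + <[z]>)%VS; last 1 first.
  - by exists b => //; apply: subv_trans ab; exact: addvSl.
  - exact: leq_trans (codim_add_line z_a) ak.
  - exact: abelian_in_minus_add.
exists a => //; split=> // z zm za; apply/negPn/negP => z_a.
by apply: noz; exists z.
Qed.

Lemma compact_aut_lfun c f : compact_aut c f ->
  exists2 h : 'End(V), lker h = 0%VS & h =1 f.
Proof.
move=> fc; have [fd _ _ _] := fc; have fl := dot_preserving_linear fd.
pose f' : {linear V -> V} := HB.pack f (GRing.isLinear.Build _ _ _ _ f fl).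
have hE : linfun f' =1 f by move=> x; rewrite lfunE.
exists (linfun f') => //; apply/eqP/lker0P => x y; rewrite !hE => fxy.
by apply: (dot_inj dotP) => z; rewrite -[LHS]fd fxy fd.
Qed.

Lemma flat_image c a (f : 'End(V)) : lker f = 0%VS ->
  compact_aut c f -> flat a -> flat (f @: a)%VS.
Proof.
move=> /eqP f0 [fd fb fs _] [[am ab] amax].
have fK z : f ((f^-1)%VF z) = z.
  apply: limg_lfunVK; suff -> : limg f = fullv by exact: memvf.
  by apply/eqP; rewrite eqEdim subvf limg_dim_eq ?leqnn// (eqP f0) capv0.
have f_inj := lker0P f0.
split; first split=> [_ /memv_imgP[x xa ->]|].
- by rewrite -fs am// linearN.
- by move=> _ _ /memv_imgP[x xa ->] /memv_imgP[y ya ->]; rewrite -fb ab// linear0.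
- move=> z zm za; rewrite -[z]fK; apply/memv_img/amax => [|x xa]; apply: f_inj.
  + by rewrite fs linearN /= fK.
  + by rewrite fb fK linear0 za// memv_img.
Qed.

Lemma flat_eq a b : flat a -> flat b -> (a <= b)%VS -> a = b.
Proof.
move=> [_ amax] [[bm bb] _] ab; apply/eqP; rewrite eqEsubv ab.
by apply/subvP => z zb; apply: amax; [exact: bm|move=> x /(subvP ab)/bb; apply].
Qed.

(* The induction enlarges the pointwise fixed common subspace c: rotate a vector
   of a so that it commutes with a vector of b, and compare a and b with a flat
   containing both of them. *)
Lemma flat_conjugate c a b : flat a -> flat b -> (c <= a)%VS -> (c <= b)%VS ->
  exists2 f : 'End(V), compact_aut c f & (f @: a)%VS = b.
Proof.
have [k] := ubnP (\dim {:V} - \dim c); elim: k c a b => // k IHk c a b ck af bf ca cb.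
have id_conj : a = b -> exists2 f : 'End(V), compact_aut c f & (f @: a)%VS = b.
  by move=> <-; exists \1%VF; [split=> *; rewrite !id_lfunE|exact: lim1g].
(* If [a] lies in [c] it lies in [b], and maximality makes them equal; likewise for [b]. *)
have [ac|/subvPn[x xa xc]] := boolP (a <= c)%VS.
  by apply/id_conj/flat_eq => //; exact: subv_trans cb.
have [bc|/subvPn[y yb yc]] := boolP (b <= c)%VS.
  by apply/id_conj/esym/flat_eq => //; exact: subv_trans ca.
have [[am ab] _] := af; have [[bm bb] _] := bf.
have [f0 f0c f0xy] : exists2 f, compact_aut c f & br (f x) y = 0.
  apply: commuting_translate; [exact: am|exact: bm| |] => w wc.
  - by apply: ab => //; exact: (subvP ca).
  - by apply: bb => //; exact: (subvP cb).
have [f f_inj ff0] := compact_aut_lfun f0c.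
have fc : compact_aut c f by rewrite (_ : (f : V -> V) = f0)//; exact/funext.
have fxy : br (f x) y = 0 by rewrite ff0.
have faf := flat_image f_inj fc af.
have fcE w : w \in c -> f w = w by case: fc => _ _ _; apply.
have cfa : (c <= f @: a)%VS.
  by apply/subvP => w wc; rewrite -(fcE w wc) memv_img// (subvP ca).
have fxa : f x \in (f @: a)%VS by exact: memv_img.
have fx_c : f x \notin c.
  apply: contra xc => fxc; suff -> : x = f x by [].
  by apply: (lker0P (introT eqP f_inj)); rewrite [RHS]fcE.
have dimc z : z \notin c -> (\dim {:V} - \dim (c + <[z]>) < k)%N.
  by move=> zc; exact: leq_trans (codim_add_line zc) ck.
have cP : abelian_in_minus c.
  split=> [w /(subvP ca)|w w' /(subvP ca) wa /(subvP ca) w'a]; first exact: am.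
  exact: ab.
have [[fam fab] _] := faf.
(* [b'] shares [c + <[f x]>] with [f @: a] and [c + <[y]>] with [b]. Both are larger than [c], so
   the induction hypothesis carries [f @: a] to [b'] and then [b'] to [b]. *)
have [b' b'f cxyb'] : exists2 b', flat b' & (c + <[f x]> + <[y]> <= b')%VS.
  apply/exists_flat/abelian_in_minus_add; first apply: abelian_in_minus_add => //.
  - exact: fam.
  - by move=> w /(subvP cfa) wa; exact: fab.
  - exact: bm.
  - move=> _ /memv_addP[w wc [_ /vlineP[l ->] ->]].
    by rewrite brDl brZl fxy scaler0 addr0 bb// (subvP cb).
have [] := IHk (c + <[f x]>)%VS (f @: a)%VS b' => //; first exact: dimc.
- by rewrite subv_add cfa -memvE.
- by apply: subv_trans cxyb'; exact: addvSl.
move=> f1 /(compact_aut_sub (addvSl _ _)) f1c f1a.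
have [] := IHk (c + <[y]>)%VS b' b => //; first exact: dimc.
- by apply: subv_trans cxyb'; rewrite -addvA addvS// addvSr.
- by rewrite subv_add cb -memvE.
move=> f2 /(compact_aut_sub (addvSl _ _)) f2c f2b.
exists (f2 \o (f1 \o f))%VF; last by rewrite !limg_comp f1a.
rewrite (_ : fun_of_lfun _ = f2 \o (f1 \o f)).
  by apply: compact_aut_comp => //; exact: compact_aut_comp.
by apply/funext => w; rewrite !comp_lfunE.
Qed.

End CompactLie.

(** The spectral theorem diagonalizes [M], and the change of basis [P] transfers this to [A]. *)
Lemma similar_normal_diagonalizable (C : numClosedFieldType) n
    (A M P : 'M[C]_n) :
  P \in unitmx -> M \is normalmx -> P *m A = M *m P -> diagonalizable A.
Proof.
move=> Pu /orthomx_spectralP ME PA; have Su := spectral_unit M.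
have SPu : spectralmx M *m P \in unitmx by rewrite unitmx_mul Su.
exists (spectralmx M *m P) => //; apply/similar_diagPex.
exists (spectral_diag M); apply/similarP => //.
by rewrite -mulmxA PA {2}ME !mulmxA mulmxV// mul1mx.
Qed.

(** * Killing form and Cartan involutions *)

Section Killing.
Variables (R : realType) (g : finLieAlgType R).
Implicit Types (x y z : g).

Lemma lieDr x y z : lie z (x + y) = lie z x + lie z y.
Proof. exact: raddfD. Qed.

Lemma lieNr x z : lie z (- x) = - lie z x.
Proof. exact: raddfN. Qed.

Lemma adE x y : ad x y = lie x y. Proof. by rewrite lfunE. Qed.

Lemma ad_linear a x y : ad (a *: x + y) = a *: ad x + ad y.
Proof.
by apply/lfunP => z; rewrite add_lfunE scale_lfunE !adE lieDl lieZl.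
Qed.

Lemma ad_lie x y : ad (lie x y) = (ad x \o ad y)%VF - (ad y \o ad x)%VF.
Proof.
apply/lfunP => z; rewrite add_lfunE opp_lfunE !comp_lfunE !adE.
have := lie_jacobi x y z; rewrite (lieC z x) lieNr (lieC z (lie x y)) => /eqP.
by rewrite subr_eq0 => /eqP <-.
Qed.

Let basis_g : basis_of {:g} (vbasis {:g}) := vbasisP _.

Lemma ad_mx_linear a x y : ad_mx (a *: x + y) = a *: ad_mx x + ad_mx y.
Proof. by rewrite /ad_mx ad_linear linearP. Qed.

(** Matrices act on row vectors, so composition reverses the products and the commutator changes
    sign. *)
Lemma ad_mx_lie x y : ad_mx (lie x y) = ad_mx y *m ad_mx x - ad_mx x *m ad_mx y.
Proof. by rewrite /ad_mx ad_lie linearB /= !(mxof_comp _ _ basis_g). Qed.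

Lemma killing_sym x y : killing x y = killing y x.
Proof. exact: mxtrace_mulC. Qed.

Lemma killing_linearl z : scalar (fun x => killing x z).
Proof.
by move=> a x y; rewrite /killing ad_mx_linear mulmxDl -scalemxAl linearP.
Qed.

Lemma killingDl x y z : killing (x + y) z = killing x z + killing y z.
Proof. by have := killing_linearl z 1 x y; rewrite scale1r mul1r. Qed.

Lemma killingNl x z : killing (- x) z = - killing x z.
Proof.
apply/eqP; rewrite -addr_eq0 -killingDl addNr; apply/eqP.
by apply: (addrI (killing 0 z)); rewrite -killingDl !addr0.
Qed.

Lemma killingDr z x y : killing z (x + y) = killing z x + killing z y.
Proof. by rewrite !(killing_sym z) killingDl. Qed.

Lemma killingNr z x : killing z (- x) = - killing z x.
Proof. by rewrite !(killing_sym z) killingNl. Qed.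

Lemma killing_lie x y z : killing (lie x y) z = killing x (lie y z).
Proof.
rewrite /killing !ad_mx_lie mulmxBl mulmxBr !linearB /= !mulmxA.
by congr (_ - _); rewrite -[in LHS]mulmxA mxtrace_mulC.
Qed.

(** As [f] is an automorphism and its own inverse, ad (f z) = f (ad z) f; the trace is invariant
    under conjugation. *)
Lemma killing_involution (f : 'End(g)) x y : lie_involution f ->
  killing (f x) (f y) = killing x y.
Proof.
move=> [[_ _ f_lie] fK].
pose F := mxof (vbasis {:g}) (vbasis {:g}) f.
have FF : F *m F = 1%:M.
  rewrite -(mxof_comp _ _ basis_g) -(mxof1 (basis_free basis_g)).
  by congr mxof; apply/lfunP => z; rewrite comp_lfunE id_lfunE fK.
have ad_f z : ad_mx (f z) = F *m ad_mx z *m F.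
  rewrite -!(mxof_comp _ _ basis_g); congr mxof.
  by apply/lfunP => w; rewrite !comp_lfunE !adE f_lie fK.
rewrite /killing !ad_f !mulmxA mxtrace_mulC !mulmxA FF mul1mx.
by rewrite -[_ *m F *m F]mulmxA FF mulmx1.
Qed.

End Killing.

Section CartanInvolution.
Variables (R : realType) (g : finLieAlgType R) (theta : 'End(g)).
Hypothesis theta_cartan : cartan_involution theta.
Implicit Types (x y z : g).

Definition cartan_dot x y := - killing x (theta y).

Lemma theta_lie x y : theta (lie x y) = lie (theta x) (theta y).
Proof. by case: theta_cartan => -[[]]. Qed.

Lemma thetaK x : theta (theta x) = x.
Proof. by case: theta_cartan => -[]. Qed.

Lemma killing_theta x y : killing (theta x) (theta y) = killing x y.
Proof. by apply: killing_involution; case: theta_cartan. Qed.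

Lemma cartan_dotP : inner_product cartan_dot.
Proof.
split=> [x y|z a x y|x x0].
- by rewrite /cartan_dot -killing_theta thetaK killing_sym.
- by rewrite /cartan_dot killing_linearl opprD mulrN.
- by case: theta_cartan => _; apply.
Qed.

Lemma cartan_dot_lie x y z :
  cartan_dot (lie x y) z = - cartan_dot y (lie (theta x) z).
Proof.
by rewrite /cartan_dot theta_lie thetaK lieC killingNl killing_lie.
Qed.

(* ad x is normal for the inner product, its adjoint being - ad (theta x). *)
Lemma normal_semisimple x : lie x (theta x) = 0 -> semisimple_elt x.
Proof.
move=> xx; have dP := cartan_dotP.
have [e eo] := exists_orthonormal dP (leqnn _).
pose b := vbasis {:g}; have bP : basis_of {:g} b := vbasisP _.
(* [P] is the change of basis from [e] to [b] and [Q] its inverse; [M y] below is the matrix of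
   [ad y] in the orthonormal basis. *)
pose P := \matrix_(i, j) coord b j (e i).
pose Q := \matrix_(i < \dim {:g}, j < \dim {:g}) cartan_dot b`_i (e j).
have PQ : P *m Q = 1%:M.
  apply/matrixP => i j; rewrite !mxE -eo [e i in RHS](coord_basis bP) ?memvf//.
  by rewrite (dot_suml dP); apply: eq_bigr => k _; rewrite !mxE (dotZl dP).
pose M y := \matrix_(i, j) cartan_dot (lie y (e i)) (e j).
have PM y : P *m ad_mx y = M y *m P.
  apply/row_matrixP => i; rewrite !row_mul.
  have -> : row i P = rVof b (e i) by apply/rowP => j; rewrite !mxE.
  rewrite -(rVof_app b bP) adE [lie y _](orthonormal_sum dP _ eo).
  rewrite linear_sum mulmx_sum_row; apply: eq_bigr => j _.
  rewrite linearZ /= !mxE; congr (_ *: _).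
  by apply/rowP => k; rewrite !mxE.
have [Pu Qu] := mulmx1_unit PQ.
have ME y : M y = P *m ad_mx y *m invmx P by rewrite PM mulmxK.
have Mtr y : (M y)^T = - M (theta y).
  by apply/matrixP => i j; rewrite !mxE cartan_dot_lie (dotC dP).
have MM : M x *m (M x)^T = (M x)^T *m M x.
  rewrite Mtr mulmxN mulNmx; congr (- _); rewrite !ME !mulmxA !mulmxKV//.
  have /eqP := ad_mx_lie x (theta x); rewrite xx -(scale0r 0) -[_ *: _]addr0.
  rewrite ad_mx_linear scale0r add0r.
  have -> : ad_mx (0 : g) = 0.
    apply: (addrI (ad_mx 0)); have := ad_mx_linear 1 (0 : g) 0.
    by rewrite !scale1r !addr0.
  by rewrite eq_sym subr_eq0 -!(mulmxA P) => /eqP ->.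
pose C := map_mx (real_complex R).
have CM : C _ _ (M x) \is normalmx.
  apply/normalmxP.
  (* The entries are real, so the conjugate transpose is the transpose. *)
  have -> : map_mx Num.conj (C _ _ (M x))^T = C _ _ (M x)^T.
    by apply/matrixP => i j; rewrite !mxE; exact: conjc_real.
  by rewrite -!map_mxM MM.
apply: (similar_normal_diagonalizable (P := C _ _ P) _ CM).
  by rewrite map_unitmx.
by rewrite -!map_mxM PM.
Qed.

End CartanInvolution.

(** * The compact dual *)

Section CompactDual.
Variables (R : realType) (g : finLieAlgType R) (theta : 'End(g)).
Hypothesis theta_cartan : cartan_involution theta.
Implicit Types (x y z : g) (a b : {vspace g}) (v w : complexification g).
Local Notation dot := (cartan_dot theta).

Definition kpart : 'End(g) := 2^-1 *: (\1 + theta)%VF.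
Definition ppart : 'End(g) := 2^-1 *: (\1 - theta)%VF.

Lemma kpartE x : kpart x = 2^-1 *: (x + theta x).
Proof. by rewrite scale_lfunE add_lfunE id_lfunE. Qed.

Lemma ppartE x : ppart x = 2^-1 *: (x - theta x).
Proof. by rewrite scale_lfunE add_lfunE opp_lfunE id_lfunE. Qed.

Let half x : 2^-1 *: (x + x) = x.
Proof.
by rewrite -mulr2n -[x *+ 2]scaler_nat scalerA mulVf ?scale1r ?pnatr_eq0.
Qed.

Lemma kpart_ppart x : kpart x + ppart x = x.
Proof. by rewrite kpartE ppartE -scalerDr addrACA subrr addr0 half. Qed.

Lemma theta_kpart x : theta (kpart x) = kpart x.
Proof. by rewrite kpartE linearZ linearD /= (thetaK theta_cartan) addrC. Qed.

Lemma theta_ppart x : theta (ppart x) = - ppart x.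
Proof.
by rewrite ppartE linearZ linearB /= (thetaK theta_cartan) -scalerN opprB.
Qed.

Lemma kpart_id x : theta x = x -> kpart x = x.
Proof. by move=> xk; rewrite kpartE xk half. Qed.

Lemma kpart0 x : theta x = - x -> kpart x = 0.
Proof. by move=> xp; rewrite kpartE xp subrr scaler0. Qed.

Lemma ppart0 x : theta x = x -> ppart x = 0.
Proof. by move=> xk; rewrite ppartE xk subrr scaler0. Qed.

Lemma ppart_id x : theta x = - x -> ppart x = x.
Proof. by move=> xp; rewrite -[RHS]kpart_ppart kpart0 ?add0r. Qed.

(** [theta] preserves the Killing form but changes the sign of one argument only. *)
Lemma killing_kpart_ppart x y : killing (kpart x) (ppart y) = 0.
Proof.
have := killing_theta theta_cartan (kpart x) (ppart y).
by rewrite theta_kpart theta_ppart killingNr; lra.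
Qed.

Lemma cartan_dotE x y :
  dot x y = killing (ppart x) (ppart y) - killing (kpart x) (kpart y).
Proof.
rewrite /cartan_dot -{1}[x]kpart_ppart -{1}[y]kpart_ppart linearD /=.
rewrite theta_kpart theta_ppart !(killingDl, killingDr, killingNl, killingNr).
rewrite [killing (ppart _) (kpart _)]killing_sym !killing_kpart_ppart; ring.
Qed.

(* The bracket of the compact dual k + i p of g = k + p, carried to g along
   x_k + i x_p |-> x_k + x_p. *)
Definition dual_lie x y : g :=
  lie (kpart x) (kpart y) - lie (ppart x) (ppart y) +
  (lie (kpart x) (ppart y) + lie (ppart x) (kpart y)).

Lemma kpart_dual_lie x y :
  kpart (dual_lie x y) = lie (kpart x) (kpart y) - lie (ppart x) (ppart y).
Proof.
rewrite linearD /= [X in X + _]kpart_id ?[X in _ + X]kpart0 ?addr0//.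
  rewrite linearD /= !(theta_lie theta_cartan) !theta_kpart !theta_ppart.
  by rewrite lieNr lieNl opprD.
rewrite linearB /= !(theta_lie theta_cartan) !theta_kpart !theta_ppart.
by rewrite lieNr lieNl opprK.
Qed.

Lemma ppart_dual_lie x y :
  ppart (dual_lie x y) = lie (kpart x) (ppart y) + lie (ppart x) (kpart y).
Proof.
apply: (addrI (kpart (dual_lie x y))); rewrite kpart_ppart kpart_dual_lie.
by [].
Qed.

(* C-linear extension of x_k + x_p |-> x_k + i x_p, and its inverse. *)
Definition of_dual v : complexification g :=
  cpair (kpart v.1 - ppart v.2) (ppart v.1 + kpart v.2).
Definition to_dual v : complexification g :=
  cpair (kpart v.1 + ppart v.2) (kpart v.2 - ppart v.1).

Lemma kkpart x : kpart (kpart x) = kpart x.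
Proof. exact/kpart_id/theta_kpart. Qed.
Lemma pkpart x : ppart (kpart x) = 0.
Proof. exact/ppart0/theta_kpart. Qed.
Lemma kppart x : kpart (ppart x) = 0.
Proof. exact/kpart0/theta_ppart. Qed.
Lemma pppart x : ppart (ppart x) = ppart x.
Proof. exact/ppart_id/theta_ppart. Qed.
Let partsE := (kkpart, pkpart, kppart, pppart).

Lemma of_dualK : cancel of_dual to_dual.
Proof.
move=> [x y]; rewrite /to_dual /of_dual /= !linearD !linearN /= !partsE.
by rewrite !(addr0, add0r, subr0, opprK, oppr0) !kpart_ppart.
Qed.

Lemma to_dualK : cancel to_dual of_dual.
Proof.
move=> [x y]; rewrite /to_dual /of_dual /= !linearD !linearN /= !partsE.
by rewrite !(addr0, add0r, subr0, opprK, oppr0) [ppart y + _]addrC !kpart_ppart.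
Qed.

Definition dual_clie v w : complexification g :=
  cpair (dual_lie v.1 w.1 - dual_lie v.2 w.2)
        (dual_lie v.1 w.2 + dual_lie v.2 w.1).

Lemma of_dual_lie v w : of_dual (dual_clie v w) = clie (of_dual v) (of_dual w).
Proof.
have of_dual_cpair p q r t : of_dual (cpair (p - q) (r + t)) =
    cpair (kpart p - kpart q - (ppart r + ppart t))
          (ppart p - ppart q + (kpart r + kpart t)).
  by rewrite /of_dual /= !linearD !linearN.
rewrite of_dual_cpair !kpart_dual_lie !ppart_dual_lie /clie /=.
rewrite !(lieDl, lieDr, lieNl, lieNr).
have dP := cartan_dotP theta_cartan.
(* Pairing with an arbitrary [z] turns an identity of vectors into one of real numbers, within reach
   of [ring]. *)
congr cpair; apply: (dot_inj dP) => z; rewrite !(dotDl dP, dotNl dP); ring.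
Qed.

Lemma dual_lieC x y : dual_lie x y = - dual_lie y x.
Proof.
have dP := cartan_dotP theta_cartan; apply: (dot_inj dP) => z; rewrite /dual_lie.
rewrite (lieC (kpart y)) (lieC (ppart y)) (lieC (kpart y)) (lieC (ppart y)).
rewrite !(dotNl dP, dotDl dP); ring.
Qed.

(** The injection [j], which is [of_dual] on pairs with second entry 0, turns [dual_lie] into
    [clie]; the Jacobi identity is pulled back along it. *)
Lemma dual_lie_jacobi x y z :
  dual_lie x (dual_lie y z) + dual_lie y (dual_lie z x) +
  dual_lie z (dual_lie x y) = 0.
Proof.
pose j u : complexification g := cpair (kpart u) (ppart u).
have jE u u' : j (dual_lie u u') = clie (j u) (j u').
  by rewrite /j kpart_dual_lie ppart_dual_lie.
have := clie_jacobi (j x) (j y) (j z); rewrite -!jE => J.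
have /= Jk := congr1 fst J; have /= Jp := congr1 snd J.
move: (dual_lie x (dual_lie y z)) (dual_lie y (dual_lie z x))
  (dual_lie z (dual_lie x y)) Jk Jp => a b c Jk Jp.
by rewrite -[LHS]kpart_ppart !linearD /= Jk Jp addr0.
Qed.

(** On the compact dual, [- dot] is the restriction of the complex Killing form, so its invariance
    comes from [killing_lie]. *)
Lemma dual_lie_dot x y z : dot (dual_lie x y) z = dot x (dual_lie y z).
Proof.
rewrite !cartan_dotE !kpart_dual_lie !ppart_dual_lie.
rewrite !(killingDl, killingNl, killingDr, killingNr) !killing_lie; ring.
Qed.

(** * The involution, Cartan subspaces in the dual, and extension to the complexification *)

Section WithInvolution.
Variable s : 'End(g).
Hypothesis s_involution : lie_involution s.
Hypothesis theta_s : forall x, theta (s x) = s (theta x).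

Lemma s_kpart x : s (kpart x) = kpart (s x).
Proof. by rewrite !kpartE linearZ linearD theta_s. Qed.

Lemma s_ppart x : s (ppart x) = ppart (s x).
Proof. by rewrite !ppartE linearZ linearB theta_s. Qed.

Lemma s_dual_lie x y : s (dual_lie x y) = dual_lie (s x) (s y).
Proof.
have s_lie u u' : s (lie u u') = lie (s u) (s u') by case: s_involution => -[].
rewrite /dual_lie; set a := lie _ _; set b := lie _ _; set c := lie _ _.
set d := lie _ _; rewrite !linearD linearN /= /a /b /c /d !s_lie.
by rewrite !s_kpart !s_ppart.
Qed.

Lemma s_cartan_dot x y : dot (s x) (s y) = dot x y.
Proof. by rewrite /cartan_dot theta_s killing_involution. Qed.

Lemma minus_spaceP x : reflect (s x = - x) (x \in minus_space s).
Proof.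
rewrite memv_ker add_lfunE opp_lfunE scale_lfunE id_lfunE scaleN1r opprK.
by rewrite addr_eq0; exact: eqP.
Qed.

Lemma kpart_mem a x : (theta @: a)%VS = a -> x \in a -> kpart x \in a.
Proof. by move=> ta xa; rewrite kpartE memvZ// memvD// -ta memv_img. Qed.

Lemma ppart_mem a x : (theta @: a)%VS = a -> x \in a -> ppart x \in a.
Proof. by move=> ta xa; rewrite ppartE memvZ// memvB// -ta memv_img. Qed.

(** The space [a + <[z]>] is abelian and stable under [theta], so each of its elements commutes with
    its image under [theta] and is semisimple by [normal_semisimple]. Maximality of [a] then absorbs
    [z]. *)
Lemma cartan_subspace_max a z : cartan_subspace s a -> (theta @: a)%VS = a ->
  z \in minus_space s -> theta z \in <[z]>%VS ->
  (forall x, x \in a -> lie x z = 0) -> z \in a.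
Proof.
move=> [[am ab _] amax] ta zm /vlineP[k tz] za.
have bb : forall x y, x \in (a + <[z]>)%VS -> y \in (a + <[z]>)%VS -> lie x y = 0.
  move=> _ _ /memv_addP[x xa [_ /vlineP[l ->] ->]]
    /memv_addP[y ya [_ /vlineP[l' ->] ->]].
  rewrite lieDl !lieDr lieZl !linearZ /= lieZl ab// za// (lieC z y) za//.
  by rewrite liexx oppr0 !scaler0 !addr0.
have <- : (a + <[z]>)%VS = a; last by apply: (subvP (addvSr _ _)); exact: memv_line.
apply: amax; last exact: addvSl.
split=> //; first by rewrite subv_add am -memvE.
move=> x xb; apply: (normal_semisimple theta_cartan); apply: bb => //.
move: xb => /memv_addP[y ya [_ /vlineP[l ->] ->]].
rewrite linearD linearZ /= tz scalerA; apply: memv_add; last exact/memvZ/memv_line.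
by rewrite -ta memv_img.
Qed.

Lemma cartan_subspace_flat a : cartan_subspace s a -> (theta @: a)%VS = a ->
  flat dual_lie s a.
Proof.
move=> aC ta; have [[am ab _] _] := aC.
split; first split=> [x xa|x y xa ya].
- by apply/minus_spaceP; exact: (subvP am).
- by rewrite /dual_lie !ab ?kpart_mem ?ppart_mem// subr0 !addr0.
move=> z zm za; have kp0 x : x \in a ->
    [/\ lie (kpart x) (kpart z) = 0, lie (kpart x) (ppart z) = 0,
        lie (ppart x) (kpart z) = 0 & lie (ppart x) (ppart z) = 0].
  move=> xa.
  (* Both parts of [x] lie in [a]. Bracketing [z] with each of them and taking k- and p-parts
     isolates the four brackets. *)
  have zk := za _ (kpart_mem ta xa); have zp := za _ (ppart_mem ta xa).
  have := kpart_dual_lie (kpart x) z; have := ppart_dual_lie (kpart x) z.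
  have := kpart_dual_lie (ppart x) z; have := ppart_dual_lie (ppart x) z.
  rewrite zk zp !linear0 !partsE !lie0l !add0r !addr0 !subr0 => <- /eqP.
  by rewrite eq_sym oppr_eq0 => /eqP -> <- <-.
have z_a (w : g) : theta w \in <[w]>%VS -> s w = - w ->
    (forall x, x \in a -> lie (kpart x) w = 0) ->
    (forall x, x \in a -> lie (ppart x) w = 0) -> w \in a.
  move=> tw /minus_spaceP wm kw pw; apply: cartan_subspace_max => // x xa.
  by rewrite -[x]kpart_ppart lieDl kw// pw// addr0.
rewrite -[z]kpart_ppart memvD//; apply: z_a.
- by rewrite theta_kpart memv_line.
- by rewrite s_kpart zm linearN.
- by move=> x /kp0[].
- by move=> x /kp0[].
- by rewrite theta_ppart memvN memv_line.
- by rewrite s_ppart zm linearN.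
- by move=> x /kp0[].
- by move=> x /kp0[].
Qed.

Lemma of_dual_linear : linear of_dual.
Proof.
move=> [l m] [x y] [x' y']; have dP := cartan_dotP theta_cartan.
rewrite /of_dual /GRing.scale /= /cscale /= cpairD /=.
rewrite !(linearD, linearN, linearZ) /=.
congr cpair; apply: (dot_inj dP) => z; rewrite !(dotDl dP, dotNl dP, dotZl dP).
  ring.
ring.
Qed.

Lemma to_dual_linear : linear to_dual.
Proof.
move=> c v w; rewrite -{1}[v]to_dualK -{1}[w]to_dualK -of_dual_linear.
exact: of_dualK.
Qed.

(** The complex-linear extension of a linear map [f] of the compact dual, transported through
    [of_dual]. *)
Definition dual_ext (f : g -> g) v : complexification g :=
  of_dual (cextend f (to_dual v)).

Lemma dual_ext_linear (f : 'End(g)) : linear (dual_ext f).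
Proof.
move=> c v w; rewrite /dual_ext to_dual_linear -of_dual_linear; congr of_dual.
case: c (to_dual v) (to_dual w) => l m [x y] [x' y'].
rewrite /cextend /GRing.scale /= /cscale /= !cpairD /=.
by rewrite !(linearD, linearN, linearZ) /=.
Qed.

Lemma dual_ext_can f h : cancel f h -> cancel (dual_ext f) (dual_ext h).
Proof.
move=> fK v; rewrite /dual_ext of_dualK -[RHS]to_dualK; congr of_dual.
by case: (to_dual v) => x y; rewrite /cextend /= !fK.
Qed.

Lemma dual_ext_lie (f : 'End(g)) :
  {morph f : x y / dual_lie x y} -> {morph dual_ext f : v w / clie v w}.
Proof.
move=> f_lie v w; rewrite /dual_ext -{1}[v]to_dualK -{1}[w]to_dualK.
rewrite -of_dual_lie of_dualK -of_dual_lie; congr of_dual.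
case: (to_dual v) (to_dual w) => x y [x' y'].
have extB p q r t : cextend f (cpair (p - q) (r + t)) =
    cpair (f p - f q) (f r + f t).
  by rewrite /cextend /= linearB linearD.
by rewrite extB !f_lie.
Qed.

(** The right-hand side is minus the complex-bilinear extension of [dot]; this is why isometries of
    [dot] extend to isometries of [killingC]. *)
Lemma killingC_of_dual v w : killingC (of_dual v) (of_dual w) =
  Complex (dot v.2 w.2 - dot v.1 w.1) (- dot v.1 w.2 - dot v.2 w.1).
Proof.
case: v w => [x y] [x' y']; rewrite /killingC !cartan_dotE /=.
rewrite !(killingDl, killingNl, killingDr, killingNr).
rewrite ![killing (ppart _) (kpart _)]killing_sym !killing_kpart_ppart.
congr Complex; ring.
Qed.

Lemma dual_ext_killingC f v w : (forall x y, dot (f x) (f y) = dot x y) ->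
  killingC (dual_ext f v) (dual_ext f w) = killingC v w.
Proof.
move=> fd; rewrite -{2}[v]to_dualK -{2}[w]to_dualK !killingC_of_dual.
by rewrite /cextend /= !fd.
Qed.

(** In dual coordinates a real [x] is [kpart x] minus i times [ppart x], which is why both parts
    have to be fixed. *)
Lemma dual_ext_real (f : 'End(g)) x :
  f (kpart x) = kpart x -> f (ppart x) = ppart x ->
  dual_ext f (of_real x) = of_real x.
Proof.
move=> fk fp; rewrite /dual_ext -[RHS]to_dualK; congr of_dual.
by rewrite /to_dual /cextend /= !linear0 addr0 add0r linearN /= fk fp.
Qed.

Lemma dual_ext_s f v : (forall x, f (s x) = s (f x)) ->
  dual_ext f (cextend s v) = cextend s (dual_ext f v).
Proof.
move=> fs; have of_s w : of_dual (cextend s w) = cextend s (of_dual w).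
  by rewrite /of_dual /cextend /= linearB linearD /= !s_kpart !s_ppart.
have to_s w : to_dual (cextend s w) = cextend s (to_dual w).
  by rewrite -[w in LHS]to_dualK -of_s of_dualK.
rewrite /dual_ext to_s -of_s; congr of_dual.
by rewrite /cextend /= !fs.
Qed.

(** The complexification of a subspace stable under [theta] is preserved by [to_dual] and [of_dual],
    which only mix k- and p-parts. *)
Lemma dual_ext_mem (f : g -> g) a b v :
  (theta @: a)%VS = a -> (theta @: b)%VS = b -> (forall x, x \in a -> f x \in b) ->
  v.1 \in a -> v.2 \in a ->
  (dual_ext f v).1 \in b /\ (dual_ext f v).2 \in b.
Proof.
move=> ta tb fab va1 va2.
by split; rewrite /= ?(memvB, memvD)// ?(kpart_mem tb, ppart_mem tb)// fab//
  ?(memvB, memvD)// (kpart_mem ta, ppart_mem ta).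
Qed.

Lemma cartan_subspaces_conjugate a b X :
  cartan_subspaces_at s X a -> cartan_subspaces_at s X b ->
  (theta @: a)%VS = a -> (theta @: b)%VS = b ->
  exists psi : complexification g -> complexification g,
    [/\ lie_automorphism psi,
        forall v, psi (cextend s v) = cextend s (psi v),
        psi @` cominus a X = cominus b X &
        psi (of_real X) = of_real X].
Proof.
move=> [aC Xa] [bC Xb] ta tb.
(* Both parts of [X] belong to [a] and to [b] by stability under [theta]; prescribing them as the
   fixed subspace makes [psi] fix [X]. *)
have [f fc fab] := flat_conjugate (cartan_dotP theta_cartan) dual_lieC
  dual_lie_jacobi dual_lie_dot s_dual_lie s_cartan_dot s_involution.2
  (c := (<[kpart X]> + <[ppart X]>)%VS)
  (cartan_subspace_flat aC ta) (cartan_subspace_flat bC tb)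
  ltac:(by rewrite subv_add -!memvE kpart_mem// ppart_mem)
  ltac:(by rewrite subv_add -!memvE kpart_mem// ppart_mem).
have [fd fl fs fX] := fc.
have [f' f'0 f'E] := compact_aut_lfun (cartan_dotP theta_cartan) fc.
have f0 : lker f == 0%VS.
  by rewrite -f'0; apply/eqP; congr lker; apply/lfunP => x; rewrite f'E.
have fK := lker0_lfunK f0; have fVK := lker0_lfunVK f0.
pose psi := dual_ext f; pose psi' := dual_ext (f^-1)%VF.
have psiK : cancel psi psi' by exact: dual_ext_can.
have psi'K : cancel psi' psi by exact: dual_ext_can.
have psiX : psi (of_real X) = of_real X.
  apply: dual_ext_real; apply: fX.
    by apply: (subvP (addvSl _ _)); exact: memv_line.
  by apply: (subvP (addvSr _ _)); exact: memv_line.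
have f_ab x : x \in a -> f x \in b by move=> xa; rewrite -fab memv_img.
have fV_ba x : x \in b -> (f^-1)%VF x \in a.
  by rewrite -fab => /memv_imgP[y ya ->]; rewrite fK.
exists psi; split=> //.
- split; [exact: dual_ext_linear|by exists psi'|exact: dual_ext_lie].
- by move=> v; exact: dual_ext_s.
(* Orthogonality to [X] is carried along because [psi] preserves [killingC] and fixes [X]. *)
- apply/seteqP; split=> [_ [v [v1 v2 vX] <-]|w [w1 w2 wX]].
    have [] := dual_ext_mem ta tb f_ab v1 v2; split=> //.
    by rewrite -psiX dual_ext_killingC.
  exists (psi' w); last exact: psi'K.
  have [] := dual_ext_mem tb ta fV_ba w1 w2; split=> //.
  by rewrite -(dual_ext_killingC _ _ fd) -/psi psi'K psiX.
Qed.

End WithInvolution.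

End CompactDual.
Theorem proposition3p6 (R : realType) (n : nat) (G : lieGroupType R n)
    (g : finLieAlgType R) (E : lie_algebra_of G g)
    (G_connected : connected [set: G])
    (G_semisimple : semisimple_lie g)
    (G_noncompact : ~ compact [set: G])
    (sigma : G -> G) (sigma_involution : group_involution sigma)
    (s : 'End(g)) (s_involution : lie_involution s)
    (s_induced : forall x : g, s x = lie_diff E sigma x)
    (H : set G) (H_subgroup : subgroup H) (H_closed : closed H)
    (H_lower : connected_component (fixed_group sigma) 1%g `<=` H)
    (H_upper : H `<=` fixed_group sigma)
    (X : g) (X_q : X \in minus_space s)
    (r : R) (r_gt0 : 0 < r)
    (X_orbit : pseudo_riemannian_orbit E s H X r)
    (theta : 'End(g)) (theta_cartan : cartan_involution theta)
    (theta_s : forall x : g, theta (s x) = s (theta x))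
    (theta_gX : (theta @: centralizer X)%VS = centralizer X)
    (m : nat) (a : 'I_m -> {vspace g})
    (a_representatives : complete_representatives E s H X a)
    (a_theta : forall i : 'I_m, (theta @: a i)%VS = a i)
    (i j : 'I_m) (i_neq_j : i <> j) :
  exists psi : complexification g -> complexification g,
    [/\ lie_automorphism psi,
        forall v : complexification g, psi (cextend s v) = cextend s (psi v),
        psi @` cominus (a i) X = cominus (a j) X &
        psi (of_real X) = of_real X].
Proof.
have [a_cartan _] := a_representatives.
exact: (cartan_subspaces_conjugate theta_cartan s_involution theta_s
  (a_cartan i) (a_cartan j) (a_theta i) (a_theta j)).
Qed.
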